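(* Let $f_L=1+X+Y\in\mathbb{F}_2[X^{\pm1},Y^{\pm1}]$ and let $X_{f_L}$ be the Ledrappier subshift, i.e. the set of all $c\in\mathbb{F}_2[[X^{\pm1},Y^{\pm1}]]$ with $f_Lc=0$. Then any low complexity $c\in X_{f_L}$ is periodic.
   Context: $\mathbb{F}_2[X^{\pm1},Y^{\pm1}]$ is the ring of Laurent polynomials over the two-element field, and $\mathbb{F}_2[[X^{\pm1},Y^{\pm1}]]$ is the set of formal two-sided power series $c=\sum_{(i,j)\in\mathbb{Z}^2}c_{i,j}X^iY^j$ (equivalently, configurations $c\in\mathbb{F}_2^{\mathbb{Z}^2}$), a module over the Laurent polynomial ring under the formal product. The translation by $\mathbf{t}\in\mathbb{Z}^2$ is $\tau_{\mathbf{t}}(c)_{\mathbf{n}}=c_{\mathbf{n}-\mathbf{t}}$. A configuration $c$ is periodic if $\tau_{\mathbf{t}}(c)=c$ for some non-zero $\mathbf{t}\in\mathbb{Z}^2$. For a finite $D\subset\mathbb{Z}^2$, $P(c,D)=\{\tau_{\mathbf{t}}(c)_{|D} : \mathbf{t}\in\mathbb{Z}^2\}$ is the set of $D$-patterns of $c$. The configuration $c$ has low complexity if $|P(c,D)|\le|D|$ for some finite $D\subset\mathbb{Z}^2$ (of any shape). *)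

(* Defs.v *)
From HB Require Import structures.
From mathcomp Require Import all_boot all_order all_algebra finmap.
From mathcomp Require Import boolp classical_sets.
From mathcomp.multinomials Require Import monalg.

Set Implicit Arguments.
Unset Strict Implicit.
Unset Printing Implicit Defensive.

Import GRing.Theory.
Local Open Scope ring_scope.

Definition Z2 : zmodType := (int * int)%type.

(* Elements of F_2[X^{+-1}, Y^{+-1}]: finitely supported families of
   coefficients indexed by Z^2, with << (i, j) >> the monomial X^i Y^j. The
   ring product of {malg _[_]} is unavailable here, since monalg asks that the
   monomials have no nontrivial units; only the action on series is needed. *)
Definition laurent : zmodType := {malg 'F_2[Z2]}.

(* Elements of F_2[[X^{+-1}, Y^{+-1}]], as coefficient functions. *)
Definition config : Type := Z2 -> 'F_2.

(* Coefficient of X^i Y^j, (i, j) = n, in the formal product f c. *)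
Definition laurent_act (f : laurent) (c : config) : config :=
  fun n => \sum_(u <- msupp f) f@_u * c (n - u).

Definition translate (t : Z2) (c : config) : config := fun n => c (n - t).

Definition periodic (c : config) : Prop :=
  exists2 t : Z2, t != 0 & translate t c = c.

Definition restrict (D : {fset Z2}) (c : config) : {ffun D -> 'F_2} :=
  [ffun d : D => c (val d)].

Definition patterns (c : config) (D : {fset Z2}) : {set {ffun D -> 'F_2}} :=
  [set p | `[< exists t : Z2, p = restrict D (translate t c) >]]%SET.

Definition low_complexity (c : config) : Prop :=
  exists D : {fset Z2}, (#|patterns c D| <= #|` D|)%N.

Definition subshift (f : laurent) : set config :=
  [set c | laurent_act f c = (fun=> 0)]%classic.

Definition LX : laurent := << ((1, 0) : Z2) >>.
Definition LY : laurent := << ((0, 1) : Z2) >>.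
Definition L1 : laurent := << (0 : Z2) >>.

Definition f_L : laurent := L1 + LX + LY.

(* Main.v *)
Require Import Defs.
From mathcomp Require Import all_boot all_algebra classical_sets.
From mathcomp Require Import all_order finmap boolp functions zify.
From mathcomp.multinomials Require Import monalg.

(* Let S be the finite shape and lift c to a 0/1-valued integer configuration.
   As there are at most |S| patterns, linear algebra over Q yields integers a_d,
   not all zero, such that sum_d a_d X^d sends c to a constant; hence g = sum_d
   a_d X^d annihilates the bounded configuration (1 - X) c. For a prime p larger
   than sum_d |a_d|, g^p = g(X^p, Y^p) mod p forces g(X^p, Y^p) to annihilate it
   too (Kari and Szabados), so g(X^k, Y^k) does for all k = 1 + j t, with t a
   suitable factorial. Eliminating the monomials of g one by one gives an
   annihilator prod_i (1 - X^(v_i)) of c with every v_i nonzero. Modulo 2, and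
   on the Ledrappier subshift, Y acts as 1 + X, which turns this product into a
   nonzero polynomial Q(X) annihilating c. Since Q divides some X^j - X^i with
   i < j, the configuration is horizontally periodic. *)

Set Implicit Arguments.
Unset Strict Implicit.
Unset Printing Implicit Defensive.

Import Order.TTheory GRing.Theory Num.Theory.
Local Open Scope ring_scope.

(** * The Frobenius identity for commuting operators *)

(** Laurent polynomials enter through the operators by which they act, so the binomial theorem is
    needed for commuting additive maps. *)
Lemma iterD_comm (M : zmodType) (A B : M -> M) (n : nat) (m : M) :
    {morph A : x y / x + y} -> {morph B : x y / x + y} ->
    (forall x, A (B x) = B (A x)) ->
  iter n (fun x => A x + B x) m =
  \sum_(i < n.+1) iter (n - i) A (iter i B m) *+ 'C(n, i).
Proof.
move=> AD BD AB.
have A0 : A 0 = 0 by apply: (addrI (A 0)); rewrite -AD !addr0.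
have B0 : B 0 = 0 by apply: (addrI (B 0)); rewrite -BD !addr0.
have AMn k x : A (x *+ k) = A x *+ k.
  by elim: k => [|k IHk]; rewrite ?mulr0n // !mulrS AD IHk.
have BMn k x : B (x *+ k) = B x *+ k.
  by elim: k => [|k IHk]; rewrite ?mulr0n // !mulrS BD IHk.
have iterAB k x : B (iter k A x) = iter k A (B x).
  by elim: k => //= k IHk; rewrite -AB IHk.
elim: n => [|n IHn]; first by rewrite big_ord_recl big_ord0 addr0.
rewrite iterS {}IHn (big_morph A AD A0) (big_morph B BD B0).
rewrite big_ord_recl [X in _ + X]big_ord_recr /=.
rewrite [RHS]big_ord_recl [X in _ = _ + X]big_ord_recr /=.
rewrite !binn !subnn !subn0 !bin0 !mulr1n -addrA.
congr (_ + _); rewrite addrA -big_split /=; congr (_ + _).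
apply: eq_bigr => i _; rewrite AMn BMn iterAB -!iterS /bump leq0n !add1n.
by rewrite subSS -subSn ?(valP i) // -mulrnDr.
Qed.

Lemma iter_prime_add (M : zmodType) (p : nat) (A B : M -> M) (m : M) :
    prime p -> (forall x : M, x *+ p = 0) ->
    {morph A : x y / x + y} -> {morph B : x y / x + y} ->
    (forall x, A (B x) = B (A x)) ->
  iter p (fun x => A x + B x) m = iter p A m + iter p B m.
Proof.
move=> p_pr pM0 AD BD AB; rewrite iterD_comm //.
case: p p_pr pM0 => // p p_pr pM0.
rewrite big_ord_recl big_ord_recr /= binn subnn bin0 big1 ?add0r //.
move=> i _; have /dvdnP[q ->] : (p.+1 %| 'C(p.+1, bump 0 i))%N.
  by apply: prime_dvd_bin => //; rewrite /bump add1n /= ltnS.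
by rewrite mulrnA pM0.
Qed.

(** This is g^p = sum_i a_i^p X^(p v_i) in characteristic p, read as an identity of operators;
    [iter_prime_add] splits off one monomial at a time. *)
Lemma iter_prime_lincomb (F : comNzRingType) (p : nat) (I : Type) (a : I -> F)
    (v : I -> Z2) (s : seq I) (c : Z2 -> F) (n : Z2) :
    p \in [pchar F] ->
  iter p (fun (x : Z2 -> F) m => \sum_(i <- s) a i * x (m - v i)) c n =
  \sum_(i <- s) a i ^+ p * c (n - v i *+ p).
Proof.
move=> charFp; have p_pr := pcharf_prime charFp.
elim: s c n => [|i s IHs] c n.
  rewrite big_nil; case: (p) (prime_gt0 p_pr) => // q _.
  by rewrite iterS big_nil.
pose A (x : Z2 -> F) : Z2 -> F := fun m => a i * x (m - v i).
pose B (x : Z2 -> F) : Z2 -> F := fun m => \sum_(j <- s) a j * x (m - v j).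
have -> : (fun (x : Z2 -> F) m => \sum_(j <- i :: s) a j * x (m - v j)) =
          (fun x => A x + B x).
  by apply: funext => x; apply: funext => m; rewrite big_cons.
rewrite iter_prime_add //.
- rewrite big_cons -IHs; congr (_ + _).
  elim: (p) n => [|q IHq] n; first by rewrite expr0 mul1r mulr0n subr0.
  by rewrite iterS /A IHq mulrA -exprS -addrA -opprD -mulrS.
- by move=> x; apply: funext => m; rewrite natmulfctE mulrn_pchar.
- by move=> x y; apply: funext => m; rewrite !addrfctE /A mulrDr.
- move=> x y; apply: funext => m; rewrite !addrfctE /B -big_split /=.
  by apply: eq_bigr => j _; rewrite mulrDr.
- move=> x; apply: funext => m; rewrite /A /B mulr_sumr.
  by apply: eq_bigr => j _; rewrite mulrCA addrAC.
Qed.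

(** * Dilating annihilators of bounded integer configurations *)

(** Since a_i^p = a_i in F_p, the sum reduces modulo p to g^p c, which vanishes because g c does. *)
Lemma dvdz_annihilator_prime (p : nat) (I : Type) (a : I -> int) (v : I -> Z2)
    (s : seq I) (c : Z2 -> int) (n : Z2) :
    prime p -> (forall m, \sum_(i <- s) a i * c (m - v i) = 0) ->
  (p %| \sum_(i <- s) a i * c (n - v i *+ p))%Z.
Proof.
move=> p_pr ann; have charFp := pchar_Fp p_pr.
rewrite (dvdz_pcharf charFp) rmorph_sum /=.
rewrite (eq_bigr
  (fun i => (a i)%:~R ^+ p * (c (n - v i *+ p))%:~R : 'F_p)); last first.
  by move=> i _; rewrite -(pFrobenius_autE charFp) rmorph_int rmorphM.
rewrite -(iter_prime_lincomb _ v s (fun m => (c m)%:~R)) //.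
set L := (X in iter p X).
have L0 k m : iter k.+1 L (fun x => (c x)%:~R) m = 0.
  elim: k m => [|k IHk] m; rewrite iterS /L.
    under eq_bigr => i _ do rewrite -rmorphM.
    by rewrite -rmorph_sum ann.
  by apply: big1 => i _; rewrite IHk mulr0.
by have := L0 p.-1 n; rewrite prednK ?prime_gt0 // => ->.
Qed.

(** The sum is a multiple of p, yet bounded by sum_i |a_i| < p. *)
Lemma annihilator_prime (p : nat) (I : Type) (a : I -> int) (v : I -> Z2)
    (s : seq I) (c : Z2 -> int) :
    prime p -> (\sum_(i <- s) `|a i|%N < p)%N -> (forall m, `|c m| <= 1) ->
    (forall m, \sum_(i <- s) a i * c (m - v i) = 0) ->
  forall n, \sum_(i <- s) a i * c (n - v i *+ p) = 0.
Proof.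
move=> p_pr lt_p c1 ann n.
have /dvdzP[q Eq] := dvdz_annihilator_prime n p_pr ann.
have leS : `|\sum_(i <- s) a i * c (n - v i *+ p)| < p%:Z.
  apply: le_lt_trans (_ : (\sum_(i <- s) `|a i|%N)%:Z < p%:Z) => //.
  apply: (le_trans (ler_norm_sum _ _ _)).
  rewrite (big_morph Posz PoszD (erefl _)); apply: ler_sum => i _.
  by rewrite normrM abszE ler_piMr.
rewrite Eq; move: leS; rewrite Eq normrM => leS.
have [->|q0] := eqVneq q 0; first by rewrite mul0r.
have : (`|p%:Z| <= `|q| * `|p%:Z|)%R by rewrite ler_peMl //; lia.
lia.
Qed.

(** Dilation changes the exponents but not the coefficients, so the bound persists and the prime
    factors of k can be treated one by one. *)
Lemma annihilator_dilate (k : nat) (I : Type) (a : I -> int) (v : I -> Z2)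
    (s : seq I) (c : Z2 -> int) :
    (0 < k)%N ->
    (forall p, prime p -> (p %| k)%N -> (\sum_(i <- s) `|a i|%N < p)%N) ->
    (forall m, `|c m| <= 1) ->
    (forall m, \sum_(i <- s) a i * c (m - v i) = 0) ->
  forall n, \sum_(i <- s) a i * c (n - v i *+ k) = 0.
Proof.
move=> k0 + c1; elim/ltn_ind: k v k0 => k IHk v k0 pk ann n.
have [k1|k1] := leqP k 1.
  have -> : k = 1%N by lia.
  exact: ann.
have [p p_pr pk'] : exists2 p, prime p & (p %| k)%N.
  by exists (pdiv k); [exact: pdiv_prime | exact: pdiv_dvd].
have lt_p := pk _ p_pr pk'; case/dvdnP: pk' => q kE.
have p1 := prime_gt1 p_pr.
rewrite (eq_bigr (fun i => a i * c (n - v i *+ p *+ q))); last first.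
  by move=> i _; rewrite kE mulnC mulrnA.
apply: (IHk q _ (fun i => v i *+ p)); [nia|nia| |].
  by move=> r r_pr rq; apply: pk => //; rewrite kE dvdn_mulr.
exact: annihilator_prime.
Qed.

(** This supplies an arithmetic progression of dilation factors free of small primes, as the
    elimination below requires. *)
Lemma prime_dvd_succ_mul_fact (N j p : nat) :
  prime p -> (p %| 1 + j * N`!)%N -> (N < p)%N.
Proof.
move=> p_pr pd; rewrite ltnNge; apply/negP => le_pN.
have pf : (p %| N`!)%N by rewrite dvdn_fact // prime_gt0.
by move: pd; rewrite dvdn_addl ?dvdn_mull // dvdn1 => /eqP p1; rewrite p1 in p_pr.
Qed.

(** * Elimination of monomials, leading to products of factors 1 - X^v *)

Definition shift_diff (R : zmodType) (c : Z2 -> R) (v : Z2) : Z2 -> R :=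
  fun n => c n - c (n - v).

(* The relations at j + 1 and at j, suitably shifted, differ by a relation in
   which one chosen d of s no longer occurs. *)
Lemma shift_diffs_vanish (R : zmodType) (t : nat) (d1 : Z2) (s : seq Z2)
    (C : Z2 -> Z2 -> R) :
    d1 \notin s ->
    (forall j n, \sum_(d <- d1 :: s) C d (n - d *+ (1 + j * t)) = 0) ->
  foldl (@shift_diff R) (C d1) [seq (d - d1) *+ t | d <- s] = (fun=> 0).
Proof.
elim: s C => [|e s IHs] C /=.
  move=> _ ann; apply: funext => n.
  by have := ann 0%N (n + d1); rewrite big_seq1 mul0n addn0 mulr1n addrK.
rewrite inE negb_or => /andP[d1e d1s] ann.
(* The shift by -e t makes the two terms at e cancel; the further shift by d1 t turns the term at d1
   into a [shift_diff]. *)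
pose C' d m := C d (m - d *+ t + d1 *+ t) - C d (m - e *+ t + d1 *+ t).
have -> : shift_diff (C d1) ((e - d1) *+ t) = C' d1.
  apply: funext => m; rewrite /C' /shift_diff subrK.
  by rewrite mulrnBl opprB addrA addrAC.
apply: (IHs C') => // j n.
have mulS_E d : d *+ (1 + j.+1 * t) = d *+ t + d *+ (1 + j * t) :> Z2.
  by rewrite mulSn addnCA mulrnDr.
have := ann j.+1 (n + d1 *+ t).
rewrite -[RHS](ann j (n - e *+ t + d1 *+ t)) => /eqP.
rewrite -subr_eq0 -sumrB !big_cons => /eqP.
have -> : n + d1 *+ t - e *+ (1 + j.+1 * t) =
          n - e *+ t + d1 *+ t - e *+ (1 + j * t).
  rewrite mulS_E opprD addrA; congr (_ - _).
  by rewrite addrAC.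
rewrite subrr add0r => E; rewrite -[RHS]E; congr (_ + _); last apply: eq_bigr => d _.
all: rewrite /C' mulS_E; congr (_ - _); congr (C _ _).
- by rewrite opprD addrA [RHS]addrAC [LHS]addrAC (addrAC n).
- by rewrite [RHS]addrAC (addrAC n).
- by rewrite opprD addrA [RHS]addrAC [LHS]addrAC (addrAC n).
- by rewrite [RHS]addrAC (addrAC n).
Qed.

Lemma Z2_mulrn_eq0 (v : Z2) (t : nat) :
  (v *+ t == 0) = (t == 0%N) || (v == 0).
Proof.
have vE : v *+ t = (v.1 *+ t, v.2 *+ t).
  by elim: t => [|t IHt]; rewrite ?mulr0n // !mulrS IHt.
by case: v vE => x y -> /=; rewrite !xpair_eqE !mulrn_eq0 -orb_andr.
Qed.

Lemma foldl_shift_diffM (R : pzRingType) (a : R) (c : Z2 -> R) (vs : seq Z2) :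
  foldl (@shift_diff R) (fun n => a * c n) vs =
  (fun n => a * foldl (@shift_diff R) c vs n).
Proof.
elim: vs c => //= v vs IHvs c; rewrite -IHvs; congr foldl.
by apply: funext => n; rewrite /shift_diff mulrBr.
Qed.

Lemma foldl_shift_diff_morph (R S : zmodType) (f : {additive R -> S})
    (c : Z2 -> R) (vs : seq Z2) :
  foldl (@shift_diff S) (f \o c) vs = f \o foldl (@shift_diff R) c vs.
Proof.
elim: vs c => //= v vs IHvs c; rewrite -IHvs; congr foldl.
by apply: funext => n; rewrite /shift_diff /= raddfB.
Qed.

(** Elimination applied to the family a_d c leaves a_(d1) times an iterated difference of c, and the
    nonzero integer a_(d1) cancels. *)
Lemma exists_shift_diffs_annihilator (s : seq Z2) (a : Z2 -> int) (d1 : Z2)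
    (c : Z2 -> int) :
    uniq s -> d1 \in s -> a d1 != 0 -> (forall m, `|c m| <= 1) ->
    (forall m, \sum_(d <- s) a d * c (m - d) = 0) ->
  exists2 vs : seq Z2, 0 \notin vs & foldl (@shift_diff int) c vs = (fun=> 0).
Proof.
move=> s_uniq d1s ad1 c1 ann.
set N := (\sum_(d <- s) `|a d|%N)%N; pose t := N`!.
exists [seq (d - d1) *+ t | d <- rem d1 s].
  apply/mapP => -[d]; rewrite mem_rem_uniq // inE => /andP[/negP dd1 _].
  move/esym/eqP; rewrite Z2_mulrn_eq0 subr_eq0 => /orP[|//].
  by rewrite /t -leqn0 leqNgt fact_gt0.
have := @shift_diffs_vanish _ t d1 (rem d1 s) (fun d n => a d * c n).
rewrite foldl_shift_diffM mem_rem_uniq // inE eqxx => /(_ isT) H.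
apply: funext => n; apply/eqP; rewrite -(mulrI_eq0 _ (lregP ad1)).
apply/eqP; apply: (congr1 (@^~ n) (H _)) => j m.
rewrite -(perm_big _ (perm_to_rem d1s)) /=.
apply: (annihilator_dilate (v := id)) => // p p_pr.
exact: prime_dvd_succ_mul_fact.
Qed.

(** * From low complexity to an annihilating product *)

Lemma exists_int_kernel (I J : finType) (M : I -> J -> int) :
    (#|I| < #|J|)%N ->
  exists2 u : J -> int, (exists j, u j != 0) &
    forall i, \sum_j u j * M i j = 0.
Proof.
move=> ltIJ.
pose A : 'M[rat]_(#|J|, #|I|) :=
  \matrix_(j, i) (M (enum_val i) (enum_val j))%:~R.
have kerA : kermx A != 0.
  by rewrite -mxrank_eq0 mxrank_ker; have := rank_leq_col A; lia.
have [w /sub_kermxP wA /matrix0Pn[i0 [j0 wj0]]] := rowV0Pn kerA.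
pose w' j := w 0 (enum_rank j).
(* A rational kernel vector times the product of all its denominators; [numq] accounts for the
   denominator at j. *)
pose u j := numq (w' j) * \prod_(k | k != j) denq (w' k).
have uE j : (u j)%:~R = w' j * (\prod_k denq (w' k))%:~R :> rat.
  rewrite (bigD1 j) //= !rmorphM /= mulrA; congr (_ * _).
  exact: numqE.
have D0 : (\prod_k denq (w' k))%:~R != 0 :> rat.
  by rewrite intr_eq0; apply/prodf_neq0 => k _; exact: denq_neq0.
exists u.
  exists (enum_val j0); rewrite -(intr_eq0 rat) uE mulf_neq0 // /w' enum_valK.
  by move: wj0; rewrite ord1.
move=> i; apply/eqP; rewrite -(intr_eq0 rat) rmorph_sum /=; apply/eqP.
transitivity ((w *m A) 0 (enum_rank i) * (\prod_k denq (w' k))%:~R); last first.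
  by rewrite wA mxE mul0r.
rewrite mxE mulr_suml big_enum_val /=.
apply: eq_bigr => j _.
by rewrite rmorphM /= uE mxE enum_rankK /w' enum_valK mulrAC.
Qed.

Lemma big_option (R : nmodType) (T : finType) (F : option T -> R) :
  \sum_x F x = F None + \sum_x F (Some x).
Proof.
rewrite (bigD1 None) //=; congr (_ + _).
rewrite (reindex_omap Some id) /=; last by case.
by apply: eq_bigl => x; rewrite eqxx.
Qed.

(** Integer values allow reduction modulo large primes, where F_2 offers only p = 2. *)
Definition int_lift (c : config) : Z2 -> int := fun n => (c n : nat)%:Z.

(** Each pattern gives one linear equation; the unknowns are a coefficient for each point of D and,
    at [None], a constant. There are more unknowns than equations. *)
Lemma low_complexity_annihilator (c : config) : low_complexity c ->
  exists (s : seq Z2) (a : Z2 -> int) (k : int),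
    [/\ uniq s, exists2 d, d \in s & a d != 0 &
        forall m, \sum_(d <- s) a d * int_lift c (m - d) = k].
Proof.
case=> D leD.
pose I : finType := 'I_#|patterns c D|.
pose M (i : I) (j : option D) : int :=
  if j is Some d then ((enum_val i) d : nat)%:Z else 1.
have [|u [j uj] Mu] := exists_int_kernel M.
  by rewrite card_ord card_option -cardfE ltnS.
have rel t : \sum_d u (Some d) * int_lift c (val d - t) = - u None.
  have Pt : Defs.restrict D (translate t c) \in patterns c D.
    by rewrite inE; apply/asboolP; exists t.
  have := Mu (enum_rank_in Pt (Defs.restrict D (translate t c))).
  rewrite big_option /= enum_rankK_in // mulr1 => /eqP.
  rewrite addrC addr_eq0 => /eqP <-.
  by apply: eq_bigr => d _; rewrite ffunE.
(* Patterns read c at d - t, while X^d reads it at m - d, hence the sign; the default 0 is taken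
   only off -D. *)
pose a d := if insub (- d) is Some d' then u (Some d') else 0.
exists [seq - d | d <- D], a, (- u None); split.
- by rewrite map_inj_uniq ?fset_uniq //; exact: oppr_inj.
(* If every coefficient on D vanished, [rel] would force the constant to vanish too. *)
- have [d ud] : exists d, u (Some d) != 0.
    case: j uj => [d ud|uN]; first by exists d.
    apply/existsP; apply: contraR uN; rewrite negb_exists => /forallP u0.
    rewrite -oppr_eq0 -(rel 0) big1 // => d _.
    by have := u0 d; rewrite negbK => /eqP ->; rewrite mul0r.
  exists (- val d); first by rewrite map_f // (valP d).
  by rewrite /a opprK valK.
- move=> m; rewrite -(rel (- m)) big_map big_seq_fsetE /=.
  by apply: eq_bigr => d _; rewrite /a opprK valK opprK addrC.
Qed.

Lemma low_complexity_shift_diffs (c : config) : low_complexity c ->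
  exists2 vs : seq Z2, 0 \notin vs &
    foldl (@shift_diff 'F_2) c vs = (fun=> 0).
Proof.
move=> /low_complexity_annihilator[s [a [k [s_uniq [d1 d1s ad1] rel]]]].
(* The factor 1 - X kills the constant k and keeps the values in {-1, 0, 1}. *)
pose e1 : Z2 := (1, 0).
have [||vs vs0 ann] := @exists_shift_diffs_annihilator s a d1
  (shift_diff (int_lift c) e1) s_uniq d1s ad1.
- move=> m; rewrite /shift_diff /int_lift.
  by case: (c m) => [[|[|//]] ?]; case: (c (m - e1)) => [[|[|//]] ?].
- move=> m; rewrite /shift_diff.
  under eq_bigr => d _ do rewrite mulrBr.
  rewrite sumrB rel.
  under [X in _ - X]eq_bigr => d _ do rewrite addrAC.
  by rewrite rel subrr.
exists (e1 :: vs); first by rewrite inE negb_or vs0 andbT.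
have -> : c = intr \o int_lift c.
  by apply: funext => n /=; rewrite /int_lift /= -pmulrn natr_Zp.
rewrite foldl_shift_diff_morph /= ann.
by apply: funext => n /=.
Qed.

(** * Polynomials in X acting on configurations *)

Lemma Z2_pairD (x y x' y' : int) : (x, y) + (x', y') = (x + x', y + y') :> Z2.
Proof. by []. Qed.

Definition poly_act (R : nzRingType) (P : {poly R}) (c : Z2 -> R) : Z2 -> R :=
  fun n => \sum_(i < size P) P`_i * c (n - (i%:Z, 0)).

Lemma poly_actE (R : nzRingType) (k : nat) (P : {poly R}) (c : Z2 -> R) n :
  (size P <= k)%N -> poly_act P c n = \sum_(i < k) P`_i * c (n - (i%:Z, 0)).
Proof.
move=> leP; rewrite /poly_act (big_ord_widen k
  (fun i => P`_i * c (n - (i%:Z, 0)))) // big_mkcond /=.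
apply: eq_bigr => i _; case: ifPn => //; rewrite -leqNgt => lePi.
by rewrite nth_default // mul0r.
Qed.

Lemma poly_actD (R : nzRingType) (P Q : {poly R}) (c : Z2 -> R) n :
  poly_act (P + Q) c n = poly_act P c n + poly_act Q c n.
Proof.
set k := maxn (size P) (size Q).
rewrite !(@poly_actE _ k) ?leq_maxl ?leq_maxr ?size_polyD // -big_split /=.
by apply: eq_bigr => i _; rewrite coefD mulrDl.
Qed.

Lemma poly_actB (R : nzRingType) (P Q : {poly R}) (c : Z2 -> R) n :
  poly_act (P - Q) c n = poly_act P c n - poly_act Q c n.
Proof. by apply/eqP; rewrite eq_sym subr_eq -poly_actD subrK. Qed.

Lemma poly_actC (R : nzRingType) (a : R) (c : Z2 -> R) n :
  poly_act a%:P c n = a * c n.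
Proof.
rewrite (@poly_actE _ 1) ?size_polyC_leq1 // big_ord1 coefC.
by rewrite (_ : (_, _) = 0 :> Z2) // subr0.
Qed.

Lemma poly_act_mulX (R : nzRingType) (P : {poly R}) (c : Z2 -> R) n :
  poly_act (P * 'X) c n = poly_act P c (n - (1, 0)).
Proof.
rewrite (@poly_actE _ (size P).+1); last first.
  by rewrite (leq_trans (size_polyMleq _ _)) // size_polyX addn2.
rewrite big_ord_recl coefMX mul0r add0r; apply: eq_bigr => i _.
rewrite coefMX /= -addrA -opprD; congr (_ * c (n - _)).
Qed.

Lemma poly_act0r (R : nzRingType) (P : {poly R}) (n : Z2) :
  poly_act P (fun=> 0) n = 0.
Proof. by apply: big1 => i _; rewrite mulr0. Qed.

Lemma poly_act_shift (R : nzRingType) (P : {poly R}) (c : Z2 -> R) (w n : Z2) :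
  poly_act P (fun m => c (m - w)) n = poly_act P c (n - w).
Proof. by apply: eq_bigr => i _; rewrite addrAC. Qed.

Lemma poly_actM (R : comNzRingType) (P Q : {poly R}) (c : Z2 -> R) :
  poly_act (P * Q) c = poly_act P (poly_act Q c).
Proof.
elim/poly_ind: P => [|P a IHP]; apply: funext => n.
  by rewrite mul0r -[0]/(0%:P) !poly_actC !mul0r.
rewrite mulrDl !poly_actD poly_actC mulrAC !poly_act_mulX IHP; congr (_ + _).
rewrite mul_polyC (@poly_actE _ (size Q) (a *: Q)) ?size_scale_leq //.
by rewrite mulr_sumr; apply: eq_bigr => i _; rewrite coefZ mulrA.
Qed.

Lemma poly_act_Xn (R : nzRingType) (k : nat) (c : Z2 -> R) n :
  poly_act 'X^k c n = c (n - (k%:Z, 0)).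
Proof.
rewrite (@poly_actE _ k.+1) ?size_polyXn // (bigD1 ord_max) //= coefXn eqxx.
rewrite mul1r big1 ?addr0 // => i; rewrite -val_eqE /= coefXn => /negPf ->.
by rewrite mul0r.
Qed.

(** Pigeonhole: there are finitely many residues modulo Q, encoded as row vectors, so two powers of
    X share one. *)
Lemma exists_Xn_eq_mod (F : finFieldType) (Q : {poly F}) : Q != 0 ->
  exists i j : nat, (i < j)%N /\ Q %| 'X^j - 'X^i.
Proof.
move=> Q0; pose f (i : 'I_#|'rV[F]_(size Q)|.+1) : 'rV[F]_(size Q) :=
  poly_rV ('X^i %% Q).
have /injectivePn[i [j ij fij]] : ~~ injectiveb f.
  by apply/injectiveP => /leq_card; rewrite card_ord ltnn.
wlog lt_ij : i j ij fij / (i < j)%N.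
  move=> H; have [|ji|/val_inj E] := ltngtP i j; first exact: H.
    by apply: (H j i) => //; rewrite eq_sym.
  by rewrite E eqxx in ij.
exists i, j; split => //; rewrite /dvdp modpD modpN subr_eq0.
have szQ k : (size ('X^k %% Q)%R <= size Q)%N.
  by rewrite ltnW // ltn_modp.
by rewrite -(poly_rV_K (szQ j)) -(poly_rV_K (szQ i)); have := fij; rewrite /f => ->.
Qed.

Lemma periodic_of_poly_act (c : config) (Q : {poly 'F_2}) :
  Q != 0 -> poly_act Q c = (fun=> 0) -> periodic c.
Proof.
move=> Q0 Qc; have [i [j [ij /dvdpP[P PQ]]]] := exists_Xn_eq_mod Q0.
exists ((j - i)%N%:Z, 0).
  by rewrite xpair_eqE eqxx andbT; lia.
have cij n : c (n - (j%:Z, 0)) = c (n - (i%:Z, 0)).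
  apply/eqP; rewrite -subr_eq0 -!poly_act_Xn; apply/eqP.
  transitivity (poly_act ('X^j - 'X^i) c n); last first.
    by rewrite PQ poly_actM Qc poly_act0r.
  by rewrite poly_actB.
apply: funext => n; rewrite /translate.
have := cij (n + (i%:Z, 0)); rewrite addrK => <-; congr c.
case: n => x y; congr pair; rewrite /=; lia.
Qed.

(** * Reduction to the variable X on the Ledrappier subshift *)

Lemma subshift_f_LP (c : config) : subshift f_L c ->
  forall n, c (n - (0, 1)) = c n + c (n - (1, 0)).
Proof.
move=> fc n; have := congr1 (@^~ n) fc; rewrite /laurent_act.
have fE u : f_L@_u = (u == 0)%:R + (u == (1, 0))%:R + (u == (0, 1))%:R.
  by rewrite /f_L /L1 /LX /LY !mcoeffD !mcoeffU !(eq_sym u).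
rewrite (perm_big [:: (0 : Z2); (1, 0); (0, 1)]) /=; last first.
  apply: uniq_perm; rewrite ?fset_uniq // => u.
  rewrite -mcoeff_neq0 fE !inE; case: (u =P 0) => [->//|_].
  by case: (u =P (1, 0)) => [->//|_]; case: (u =P (0, 1)).
have [f0 f1 f2] : [/\ f_L@_0 = 1, f_L@_(1, 0) = 1 & f_L@_(0, 1) = 1].
  by split; rewrite fE; apply/val_inj.
rewrite !big_cons big_nil f0 f1 f2 !mul1r subr0 addr0 addrA => /eqP.
by rewrite addr_eq0 (oppr_pchar2 (pchar_Fp _)) // => /eqP ->.
Qed.

(** The image of X^a Y^b under Y = 1 + X; natural exponents keep it a polynomial. *)
Definition XY_poly (a b : nat) : {poly 'F_2} := 'X^a * (1 + 'X) ^+ b.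

Lemma poly_act_XY (c : config) (a b : nat) : subshift f_L c ->
  forall n, poly_act (XY_poly a b) c n = c (n - (a%:Z, b%:Z)).
Proof.
move=> /subshift_f_LP fc n; rewrite poly_actM poly_act_Xn /=.
rewrite (_ : n - (a%:Z, b%:Z) = n - (a%:Z, 0) - (0, b%:Z)); last first.
  by rewrite -addrA -opprD Z2_pairD addr0 add0r.
elim: b (n - _) => [|b IHb] m.
  by rewrite expr0 -[1]/(1%:P) poly_actC mul1r (_ : (0, _) = 0 :> Z2) // subr0.
rewrite exprS poly_actM poly_actD -[1]/(1%:P) poly_actC mul1r.
rewrite (poly_act_Xn 1) !IHb.
by rewrite addrAC -fc -addrA -opprD Z2_pairD addr0 intS (addrC 1).
Qed.

(** Over F_2, the values at 0 and at 1 tell whether a = 0 and whether b = 0. *)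
Lemma XY_poly_eq_disjoint (a b a' b' : nat) :
    (a == 0%N) || (a' == 0%N) -> (b == 0%N) || (b' == 0%N) ->
    XY_poly a b = XY_poly a' b' ->
  [/\ a = 0, b = 0, a' = 0 & b' = 0]%N.
Proof.
have at0 k l : (XY_poly k l).[0] = (k == 0%N)%:R.
  rewrite hornerM hornerXn horner_exp hornerD hornerC hornerX addr0.
  by rewrite expr1n mulr1 expr0n.
have at1 k l : (XY_poly k l).[1] = (l == 0%N)%:R.
  rewrite hornerM hornerXn horner_exp hornerD hornerC hornerX expr1n mul1r.
  by rewrite (_ : 1 + 1 = 0) ?expr0n //; exact/val_inj.
move=> aa bb E; have := congr1 (horner^~ 0) E; have := congr1 (horner^~ 1) E.
rewrite !at0 !at1.
by case: a b a' b' aa bb {E} => [|a] [|b] [|a'] [|b'].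
Qed.

(** Keeps the induction over the factors 1 - X^v inside the subshift. *)
Lemma subshift_shift_diff (f : laurent) (c : config) (v : Z2) :
  subshift f c -> subshift f (shift_diff c v).
Proof.
move=> fc; apply: funext => n.
rewrite /laurent_act /shift_diff.
under eq_bigr => u _ do rewrite mulrBr addrAC.
rewrite sumrB -[X in X - _]/(laurent_act f c n).
by rewrite -[X in _ - X]/(laurent_act f c (n - v)) fc subrr.
Qed.

Lemma int_nat_diff (x : int) :
  exists a b : nat, x = a%:Z - b%:Z /\ (a == 0%N) || (b == 0%N).
Proof.
by case: x => k; [exists k, 0%N | exists 0%N, k.+1]; split; lia.
Qed.

(* On the subshift, Y acts as 1 + X, so each X^v - 1 acts up to a unit as a
   nonzero polynomial in X alone. *)
Lemma exists_poly_act0 (vs : seq Z2) (c : config) :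
    subshift f_L c -> 0 \notin vs -> foldl (@shift_diff 'F_2) c vs = (fun=> 0) ->
  exists2 Q : {poly 'F_2}, Q != 0 & poly_act Q c = (fun=> 0).
Proof.
elim: vs c => [|v vs IHvs] c fc /=.
  move=> _ ->; exists 1; rewrite ?oner_eq0 //.
  by apply: funext => n; exact: poly_act0r.
rewrite inE negb_or => /andP[v0 vs0] ann.
have [Q Q0 Qc] := IHvs _ (subshift_shift_diff v fc) vs0 ann.
case: v v0 Qc {ann} => x y; have [a [a' [-> aa]]] := int_nat_diff x.
have [b [b' [-> bb]]] := int_nat_diff y => v0 Qc.
(* For v = (a - a', b - b'), multiplying 1 - X^v by the unit X^a' Y^b' gives X^a' Y^b' - X^a Y^b,
   without negative exponents. *)
exists (Q * (XY_poly a' b' - XY_poly a b)).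
  rewrite mulf_neq0 // subr_eq0; apply: contraNneq v0 => E.
  by have [-> -> -> ->] := XY_poly_eq_disjoint aa bb (esym E).
rewrite poly_actM.
rewrite (_ : poly_act _ c = fun n =>
  shift_diff c (a%:Z - a'%:Z, b%:Z - b'%:Z) (n - (a'%:Z, b'%:Z))).
  by apply: funext => n; rewrite poly_act_shift Qc.
apply: funext => n; rewrite poly_actB !poly_act_XY // /shift_diff.
by rewrite -[X in _ = _ - c X]addrA -opprD Z2_pairD !(addrC _ (_ - _)) !subrK.
Qed.

Theorem theorem6 (c : config) :
  subshift f_L c -> low_complexity c -> periodic c.
Proof.
move=> fc /low_complexity_shift_diffs[vs vs0 ann].
have [Q Q0 Qc] := exists_poly_act0 fc vs0 ann.
exact: periodic_of_poly_act Q0 Qc.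
Qed.
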